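(* Let $G$ be a graph on $[n]$ and $q\in \mathcal{M}_G$, where $q=P_{T}(H)$ for some graph $H$ on $[n]$ and some $T\subseteq [n]$ with $|T|=n-2$. (a) If $c_H(T)=2$, then $(q,1_{\mathcal{M}_G})$ is connected if and only if $G\notin \mathcal{G}_T$. (b) If $c_H(T)=1$, then $\widetilde{H}^{1}((q,1_{\mathcal{M}_G});\mathbb{K})=0$ if and only if $G\notin \mathcal{G}_{T}$.
   Context: All graphs are finite and simple. $[n]=\{1,\ldots,n\}$, $\mathbb{K}$ is a field, $S=\mathbb{K}[x_1,\ldots,x_n,y_1,\ldots,y_n]$, $f_{ij}=x_iy_j-x_jy_i$, and the binomial edge ideal $J_G\subseteq S$ of a graph $G$ on $[n]$ is generated by all $f_{ij}$ with $\{i,j\}\in E(G)$, $i<j$. For a graph $H$ on $[n]$ and $T\subseteq[n]$, $H-T$ is the induced subgraph on $[n]\setminus T$, $c_H(T)$ is the number of connected components $H_1,\ldots,H_{c_H(T)}$ of $H-T$, $\widetilde{H}_i$ is the complete graph on $V(H_i)$, and $$P_T(H)=(x_v,y_v)_{v\in T}+J_{\widetilde H_1}+\cdots+J_{\widetilde H_{c_H(T)}}.$$ These are prime ideals and $J_G=\bigcap_{T\subseteq[n]}P_T(G)$. For a decomposition $I=q_1\cap\cdots\cap q_t$ of an ideal $I$, $\mathcal{R}_I$ denotes the poset, ordered by reverse inclusion, of all possible sums of ideals in this decomposition. $\mathcal{R}_G$ is this poset for $J_G=\bigcap_{T\subseteq[n]}P_T(G)$ (all subsets $T$ of $[n]$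 are used). The poset $(\mathcal{M}_G,\preccurlyeq)$, ordered by reverse inclusion, consists of: the prime ideals in $\mathcal{R}_G$; the prime ideals in the posets $\mathcal{R}_I$ arising from the decompositions $$I=q_1\cap\cdots\cap q_t\cap(q_1+P_\emptyset(G))\cap\cdots\cap(q_t+P_\emptyset(G)),$$ where $I$ ranges over the non-prime ideals in $\mathcal{R}_G$ and $q_1,\ldots,q_t$ are the minimal primes of $I$; and the prime ideals obtained by repeating this procedure every time a non-prime ideal is found. (The procedure terminates after finitely many steps.) Let $1_{\mathcal{M}_G}$ be a terminal (top) element added to $\mathcal{M}_G$. For $q\in\mathcal{M}_G$, $(q,1_{\mathcal{M}_G})=\{z\in\mathcal{M}_G: q\preccurlyeq z\preccurlyeq 1_{\mathcal{M}_G},\ z\neq q,\ z\neq 1_{\mathcal{M}_G}\}$, i.e. the elements of $\mathcal{M}_G$ properly contained in $q$ as ideals. The order complex $\Delta(\mathcal{P})$ of a poset $\mathcal{P}$ is the simplicial complex whose facets are the maximal chains of $\mathcal{P}$; if $\mathcal{P}$ is empty then $\Delta(\mathcal{P})=\{\emptyset\}$. $\mathcal{P}$ is connected if the $1$-skeleton graph of $\Delta(\mathcal{P})$ is connected, i.e. any two distinct vertices are joined by a path (so an empty poset counts as connected). $\widetilde{H}^i(\mathcal{P};\mathbb{K})$ is the reduced simplicial cohomology of $\Delta(\mathcal{P})$ with coefficients in $\mathbb{K}$. For $T\subseteq[n]$ with $|T|=n-2$, $\mathcal{G}_T$ is the family of graphs $G$ on $[n]$ for which the two elements $u,w$ of $[n]\setminus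 T$ (named in a suitable order) are non-adjacent in $G$ and there exist three pairwise disjoint subsets $V_0,V_1,V_2$ of $T$ with $V_1,V_2\neq\emptyset$ and $V_0\cup V_1\cup V_2=T$ such that (1) $N_G(u)=V_0\cup V_1$ and $N_G(w)=V_0\cup V_2$; (2) $\{v_1,v_2\}\in E(G)$ for every $v_1\in V_1$, $v_2\in V_2$. Here $N_G(v)$ is the set of vertices adjacent to $v$. *)

(* Defs.v *)
From HB Require Import structures.
From mathcomp Require Import all_boot all_order all_algebra.
From mathcomp Require Import mpoly.
From mathcomp Require Import classical_sets.
From Stdlib Require Import Relation_Operators.

Set Implicit Arguments.
Unset Strict Implicit.
Unset Printing Implicit Defensive.

Import GRing.Theory.
Local Open Scope ring_scope.

(* Ideals of a commutative ring R are classical sets of type [set R], so that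
   equality of ideals is Leibniz equality. *)
Section Ideals.
Local Open Scope classical_set_scope.
Variable R : comNzRingType.
Implicit Types I J P Q : set R.

Definition is_ideal I : Prop :=
  [/\ I 0, forall a b, I a -> I b -> I (a + b) & forall r a, I a -> I (r * a)].

Definition is_prime P : Prop :=
  [/\ is_ideal P, ~ P 1 & forall a b, P (a * b) -> P a \/ P b].

Definition minimal_prime I P : Prop :=
  [/\ is_prime P, I `<=` P &
      forall Q, is_prime Q -> I `<=` Q -> Q `<=` P -> Q = P].

Definition ideal_gen (A : set R) : set R :=
  [set p | exists (k : nat) (r g : 'I_k -> R),
     (forall i, A (g i)) /\ p = \sum_i r i * g i].

Definition ideal_add I J : set R :=
  [set p | exists a b, [/\ I a, J b & p = a + b]].

Definition ideal_sum (X : finType) (D : {set X}) (F : X -> set R) : set R :=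
  [set p | exists a : X -> R,
     (forall x, x \in D -> F x (a x)) /\ p = \sum_(x in D) a x].

(* The poset R_I attached to a decomposition of I as the intersection of the
   ideals in D: it depends only on D, and consists of the sums of nonempty
   finite families of members of D (the empty sum is not taken). *)
Definition sum_poset (D : set (set R)) : set (set R) :=
  [set J | exists (k : nat) (q : 'I_k.+1 -> set R),
     (forall i, D (q i)) /\ J = ideal_sum [set: 'I_k.+1] q].

(* The decomposition q_1, ..., q_t, q_1 + P, ..., q_t + P, where q_1, ..., q_t
   are the minimal primes of I. *)
Definition augmented_decomposition P I : set (set R) :=
  [set J | minimal_prime I J \/
           exists2 q, minimal_prime I q & J = ideal_add q P].

(* Strict order of the posets of ideals, ordered by reverse inclusion. *)
Definition prec I J : Prop := J `<` I.

End Ideals.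

(* A poset is given by a strict order lt on a type X and a set P of elements. *)
Section OrderComplex.
Local Open Scope classical_set_scope.
Variables (X : Type) (lt : X -> X -> Prop).
Implicit Type P : set X.

(* The faces of the order complex of P with k vertices, i.e. the chains of P
   with k elements, each listed in increasing order. *)
Definition order_simplex P (k : nat) (s : 'I_k -> X) : Prop :=
  (forall i, P (s i)) /\ (forall i j : 'I_k, (i < j)%N -> lt (s i) (s j)).

Definition skeleton_adj P (x y : X) : Prop :=
  [/\ P x, P y & lt x y \/ lt y x].

Definition poset_connected P : Prop :=
  forall x y, P x -> P y -> clos_refl_trans X (skeleton_adj P) x y.

Variable K : fieldType.

(* Cochains of degree k - 1 are functions on simplices with k vertices (only
   their values on actual simplices matter); for k = 0 this is the
   augmentation term, the empty simplex being a face. *)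
Definition cochain (k : nat) := ('I_k -> X) -> K.

Definition coboundary (k : nat) (f : cochain k) : cochain k.+1 :=
  fun s => \sum_(j < k.+1) (-1) ^+ j * f (fun i => s (lift j i)).

Definition is_cocycle P (k : nat) (f : cochain k) : Prop :=
  forall s : 'I_k.+1 -> X, order_simplex P s -> coboundary f s = 0.

Definition is_coboundary P (k : nat) (f : cochain k.+1) : Prop :=
  exists g : cochain k,
    forall s : 'I_k.+1 -> X, order_simplex P s -> f s = coboundary g s.

(* The reduced cohomology in degree d, with coefficients in K, is zero. *)
Definition reduced_cohomology_eq0 P (d : nat) : Prop :=
  forall f : cochain d.+1, is_cocycle P f -> is_coboundary P f.

End OrderComplex.

Record sgraph (n : nat) := SGraph {
  adj :> rel 'I_n;
  adj_sym : ssrbool.symmetric adj;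
  adj_irr : irreflexive adj }.

Section Graphs.
Variable n : nat.
Implicit Types (G H : sgraph n) (T : {set 'I_n}).

Definition neighbors G (v : 'I_n) : {set 'I_n} := [set w | G v w].

Definition deletion H T : rel 'I_n :=
  [rel i j | [&& i \notin T, j \notin T & H i j]].

Definition components H T : {set {set 'I_n}} :=
  equivalence_partition (connect (deletion H T)) (~: T).

Definition num_components H T : nat := #|components H T|.

Definition complete_on (C : {set 'I_n}) : rel 'I_n :=
  [rel i j | [&& i \in C, j \in C & i != j]].

Definition in_family_GT T G : Prop :=
  exists u w : 'I_n, exists V0 V1 V2 : {set 'I_n},
    [/\ [/\ u != w, ~: T = [set u; w] & ~~ G u w],
        [/\ [disjoint V0 & V1], [disjoint V0 & V2] & [disjoint V1 & V2]],
        [/\ V1 != finset.set0, V2 != finset.set0 & V0 :|: V1 :|: V2 = T],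
        neighbors G u = V0 :|: V1 /\ neighbors G w = V0 :|: V2 &
        forall v1 v2, v1 \in V1 -> v2 \in V2 -> G v1 v2].

End Graphs.

Section BinomialEdgeIdeals.
Local Open Scope classical_set_scope.
Variables (K : fieldType) (n : nat).
Local Notation S := {mpoly K[n + n]}.
Implicit Types (G H : sgraph n) (T : {set 'I_n}).

Definition xvar (i : 'I_n) : S := 'X_(lshift n i).
Definition yvar (i : 'I_n) : S := 'X_(rshift n i).
Definition fbin (i j : 'I_n) : S := xvar i * yvar j - xvar j * yvar i.

(* Isolated vertices do not matter, so e may also be the edge relation of a
   graph on a subset of the vertices. *)
Definition binomial_edge_ideal (e : rel 'I_n) : set S :=
  ideal_gen [set p | exists i j : 'I_n, [/\ (i < j)%N, e i j & p = fbin i j]].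

Definition variable_ideal T : set S :=
  ideal_gen [set p | exists2 v, v \in T & p = xvar v \/ p = yvar v].

Definition P_ideal T H : set S :=
  ideal_add (variable_ideal T)
    (ideal_sum (components H T) (fun C => binomial_edge_ideal (complete_on C))).

Definition RG_poset G : set (set S) :=
  sum_poset [set J | exists T, J = P_ideal T G].

(* All ideals, prime or not, met in the construction of M_G. *)
Inductive MG_stage G : set S -> Prop :=
| MG_init I : RG_poset G I -> MG_stage G I
| MG_step I J : MG_stage G I -> ~ is_prime I ->
    sum_poset (augmented_decomposition (P_ideal finset.set0 G) I) J ->
    MG_stage G J.

Definition MG_poset G : set (set S) :=
  [set q | MG_stage G q /\ is_prime q].

(* The open interval (q, 1), where 1 is a top element added to M_G. *)
Definition MG_interval G (q : set S) : set (set S) :=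
  [set z | MG_poset G z /\ prec q z].

End BinomialEdgeIdeals.

(* Main.v *)
From HB Require Import structures.
Require Import Defs.
From mathcomp Require Import all_boot all_order all_algebra.
From mathcomp Require Import mpoly ring.
From mathcomp Require Import boolp classical_sets.
From Stdlib Require Import Relation_Operators.

Set Implicit Arguments.
Unset Strict Implicit.
Unset Printing Implicit Defensive.

Import GRing.Theory.

(** Every prime of M_G has the form (x_v, y_v : v in T) + (f_ij : i ~ j) for a
set T and an equivalence ~ on its complement. For a prime z of M_G let T(z) be
the set of v with x_v, y_v in z. Only two features of z are used. Since z is
prime and contains J_G, it contains P_T(z)(G), because
x_a f_ij = x_i f_aj + x_j f_ia lets f propagate along paths that avoid T(z)
([prime_path]). And z lies in the hull (x_v, y_v : v in T(z)) + P_0(G), where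
P_0(G) is the ideal of the empty set: this survives sums and, since the part of
a prime spanned by its variables and its binomials f_ij with i, j in one
component of G is again prime, also the passage to minimal primes
([spanned_stage]). The ideals that have to be exhibited as members of M_G are
all sums P_U(G) + P_V(G) with U contained in V. Such a sum is generated by the
variables of V and the f_ij with i, j in one component of G - U, hence is prime.
Primality comes from the toric parametrization x_v -> y_v x_(r v), y_v -> y_v,
where r picks a representative in each block ([toric_kernel]).

Let u, w be the two vertices outside T, and let m be generated by the variables
of T. The members of M_G properly inside m are the z in M_G, z contained in m,
with T(z) a proper subset of T; then T(z) separates u from w in G. Each such z
is joined to P_U(G), U = T(z), then, through P_U(G) + P_(T-t)(G), to P_(T-t)(G)
for any t in T - U, so everything reduces to the vertices t of T that are not
adjacent to both u and w. Two of them are joined as soon as deleting all the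
rest of T separates u from w. Vertices not adjacent to w are joined to each
other, likewise those not adjacent to u, and these two classes stay apart only
in the situation defining the family G_T ([interval_connected]). Conversely, in
that situation T(z) contains exactly one of N(u) and N(w), and this choice is
constant along comparabilities ([family_disconnected]).

If u and w lie in one component, so that q = m + (f_uw), the members z of the
interval with T(z) different from T form a cone, contracted by going from z to
its hull and from there to P_0(G). When u and w are adjacent, this is the whole
interval. Otherwise m is the only further member, so the interval is the
suspension of the interval of m, and its cohomology in degree 1 vanishes exactly
when the latter is connected ([suspension_cohomology1]). *)

(** * Ideals given by generators *)

Section Ideals.
Local Open Scope classical_set_scope.
Local Open Scope ring_scope.
Variable R : comNzRingType.
Implicit Types I J A : set R.

Lemma ideal0 I : is_ideal I -> I 0. Proof. by case. Qed.

Lemma idealD I a b : is_ideal I -> I a -> I b -> I (a + b).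
Proof. by case=> _ + _; apply. Qed.

Lemma idealMl I r a : is_ideal I -> I a -> I (r * a).
Proof. by case=> _ _; apply. Qed.

Lemma idealN I a : is_ideal I -> I a -> I (- a).
Proof. by move=> hI Ia; rewrite -mulN1r; apply: idealMl. Qed.

Lemma idealB I a b : is_ideal I -> I a -> I b -> I (a - b).
Proof. by move=> hI Ia Ib; apply: idealD => //; apply: idealN. Qed.

Lemma ideal_big I (X : Type) (s : seq X) (P : pred X) (F : X -> R) :
  is_ideal I -> (forall x, P x -> I (F x)) -> I (\sum_(x <- s | P x) F x).
Proof.
move=> hI hF; elim/big_ind: _ => //; first exact: ideal0.
by move=> a b; apply: idealD.
Qed.

Lemma ideal_gen_ideal A : is_ideal (ideal_gen A).
Proof.
split.
- exists 0%N, (fun=> 0), (fun=> 0); split; first by case.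
  by rewrite big_ord0.
- move=> _ _ [k1 [r1 [g1 [A1 ->]]]] [k2 [r2 [g2 [A2 ->]]]].
  exists (k1 + k2)%N,
    (fun i => match split i with inl j => r1 j | inr j => r2 j end),
    (fun i => match split i with inl j => g1 j | inr j => g2 j end).
  split; first by move=> i; case: (split i).
  rewrite big_split_ord; congr (_ + _); apply: eq_bigr => i _.
    by rewrite (unsplitK (inl i)).
  by rewrite (unsplitK (inr i)).
- move=> c _ [k [r [g [Ag ->]]]].
  exists k, (fun i => c * r i), g; split=> //.
  by rewrite big_distrr /=; apply: eq_bigr => i _; rewrite mulrA.
Qed.

Lemma mem_ideal_gen A a : A a -> ideal_gen A a.
Proof.
move=> Aa; exists 1%N, (fun=> 1), (fun=> a); split=> //.
by rewrite big_ord1 mul1r.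
Qed.

Lemma ideal_gen_min A I : is_ideal I -> A `<=` I -> ideal_gen A `<=` I.
Proof.
move=> hI AI _ [k [r [g [Ag ->]]]]; apply: ideal_big => // i _.
by apply: idealMl => //; apply: AI.
Qed.

Lemma ideal_add_ideal I J : is_ideal I -> is_ideal J -> is_ideal (ideal_add I J).
Proof.
move=> hI hJ; split.
- by exists 0, 0; split; [exact: ideal0|exact: ideal0|rewrite addr0].
- move=> _ _ [a [b [Ia Jb ->]]] [c [d [Ic Jd ->]]].
  exists (a + c), (b + d); split; [exact: idealD|exact: idealD|].
  by rewrite addrACA.
- move=> r _ [a [b [Ia Jb ->]]]; exists (r * a), (r * b).
  by split; [exact: idealMl|exact: idealMl|rewrite mulrDr].
Qed.

Lemma ideal_add_subl I J : is_ideal J -> I `<=` ideal_add I J.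
Proof. by move=> hJ a Ia; exists a, 0; split=> //; [exact: ideal0|rewrite addr0]. Qed.

Lemma ideal_add_subr I J : is_ideal I -> J `<=` ideal_add I J.
Proof. by move=> hI a Ia; exists 0, a; split=> //; [exact: ideal0|rewrite add0r]. Qed.

Lemma ideal_add_min I J L :
  is_ideal L -> I `<=` L -> J `<=` L -> ideal_add I J `<=` L.
Proof.
by move=> hL IL JL _ [a [b [Ia Jb ->]]]; apply: idealD; [|apply: IL|apply: JL].
Qed.

Section Sum.
Variables (X : finType) (D : {set X}) (F : X -> set R).
Hypothesis hF : forall x, x \in D -> is_ideal (F x).

Lemma ideal_sum_ideal : is_ideal (ideal_sum D F).
Proof.
split.
- exists (fun=> 0); split; last by rewrite big1.
  by move=> x xD; apply: ideal0; apply: hF.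
- move=> _ _ [a [ha ->]] [b [hb ->]]; exists (fun x => a x + b x).
  split; last by rewrite big_split.
  by move=> x xD; apply: idealD; [exact: hF|exact: ha|exact: hb].
- move=> r _ [a [ha ->]]; exists (fun x => r * a x).
  split; last by rewrite big_distrr.
  by move=> x xD; apply: idealMl; [exact: hF|exact: ha].
Qed.

Lemma ideal_sum_sub x : x \in D -> F x `<=` ideal_sum D F.
Proof.
move=> xD a Fa; exists (fun y => if y == x then a else 0); split.
  by move=> y yD; case: eqP => [->//|_]; apply: ideal0; apply: hF.
by rewrite (bigD1 x) //= eqxx big1 ?addr0 // => y /andP[_ /negPf->].
Qed.

Lemma ideal_sum_min L :
  is_ideal L -> (forall x, x \in D -> F x `<=` L) -> ideal_sum D F `<=` L.
Proof.
move=> hL FL _ [a [ha ->]]; apply: ideal_big => // x xD.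
by apply: (FL x xD); apply: ha.
Qed.

End Sum.

Lemma proper_witness I J a : I `<=` J -> J a -> ~ I a -> prec J I.
Proof. by move=> IJ Ja nIa; split=> // /(_ a Ja). Qed.

End Ideals.

(** * Ideals generated by pairs of variables and binomials *)

Section BlockIdeals.
Local Open Scope ring_scope.
Variables (K : fieldType) (n : nat).
Local Notation S := {mpoly K[n + n]}.
Local Notation x := (@xvar K n).
Local Notation y := (@yvar K n).
Local Notation f := (@fbin K n).
Implicit Types (T U : {set 'I_n}) (e : rel 'I_n).

(** The relation e may also relate vertices of T: the corresponding binomials
already lie in the ideal of the variables of T. *)
Definition block_ideal T e : set S :=
  ideal_gen (fun p => (exists2 v, v \in T & p = x v \/ p = y v) \/
                      (exists i j, e i j /\ p = f i j)).

Lemma block_ideal_ideal T e : is_ideal (block_ideal T e).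
Proof. exact: ideal_gen_ideal. Qed.
Hint Resolve block_ideal_ideal : core.

Lemma block_x T e v : v \in T -> block_ideal T e (x v).
Proof. by move=> vT; apply: mem_ideal_gen; left; exists v; [|left]. Qed.

Lemma block_y T e v : v \in T -> block_ideal T e (y v).
Proof. by move=> vT; apply: mem_ideal_gen; left; exists v; [|right]. Qed.

Lemma block_f T e i j : e i j -> block_ideal T e (f i j).
Proof. by move=> eij; apply: mem_ideal_gen; right; exists i, j. Qed.

Lemma fbin_vars (I : set S) i j : is_ideal I ->
  I (x i) -> I (y i) -> I (f i j).
Proof.
move=> hI Ix Iy; rewrite /fbin; apply: idealB => //; last exact: idealMl.
by rewrite mulrC; apply: idealMl.
Qed.

Lemma fbin_sym i j : f j i = - f i j.
Proof. by rewrite /fbin opprB. Qed.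

Lemma fbinxx i : f i i = 0.
Proof. by rewrite /fbin subrr. Qed.

Lemma block_sub T e (I : set S) : is_ideal I ->
    (forall v, v \in T -> I (x v) /\ I (y v)) ->
    (forall i j, i \notin T -> j \notin T -> e i j -> I (f i j)) ->
  (block_ideal T e `<=` I)%classic.
Proof.
move=> hI hT he; apply: ideal_gen_min => // p [[v vT [->|->]]|[i [j [eij ->]]]].
- by have [] := hT v vT.
- by have [] := hT v vT.
have [iT|iT] := boolP (i \in T).
  by have [? ?] := hT i iT; apply: fbin_vars.
have [jT|jT] := boolP (j \in T); last exact: he.
rewrite fbin_sym; apply: idealN => //.
by have [? ?] := hT j jT; apply: fbin_vars.
Qed.

Lemma block_mono T U e e' : T \subset U ->
    (forall i j, i \notin U -> j \notin U -> e i j -> e' i j) ->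
  (block_ideal T e `<=` block_ideal U e')%classic.
Proof.
move=> TU ee'.
have hv v : v \in U -> block_ideal U e' (x v) /\ block_ideal U e' (y v).
  by move=> vU; split; [apply: block_x|apply: block_y].
apply: block_sub => // [v vT|i j _ _ eij].
  by apply: hv; apply: (fintype.subsetP TU).
have [iU|iU] := boolP (i \in U).
  by have [? ?] := hv i iU; apply: fbin_vars.
have [jU|jU] := boolP (j \in U); last by apply: block_f; apply: ee'.
by rewrite fbin_sym; apply: idealN => //; have [? ?] := hv j jU; apply: fbin_vars.
Qed.

Lemma eq_block T e e' :
    (forall i j, i \notin T -> j \notin T -> e i j = e' i j) ->
  block_ideal T e = block_ideal T e'.
Proof.
by move=> ee'; apply/seteqP; split; apply: block_mono => // i j iT jT;
  rewrite ee'.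
Qed.

(** * The toric parametrization of a block ideal *)

Section Toric.
Variables (T : {set 'I_n}) (r : 'I_n -> 'I_n).

Local Notation exp := 'X_{1..n + n}.
Local Notation ex v := (lshift n v).
Local Notation ey v := (rshift n v).

(** The image of a variable under x_v -> y_v x_(r v), y_v -> y_v. The generic
rank one matrix of a block would have rows (a_v s_C) and (a_v t_C); putting
t_C = 1 and reusing y_v for a_v loses nothing, because the total degree in each
pair x_v, y_v is still visible. *)
Definition toric_exp (i : 'I_(n + n)) : exp :=
  match split i with
  | inl v => (U_(ey v) + U_(ex (r v)))%MM
  | inr v => U_(ey v)%MM
  end.

Definition vertex (i : 'I_(n + n)) : 'I_n :=
  match split i with inl v => v | inr v => v end.

Definition toric_var (i : 'I_(n + n)) : S :=
  if vertex i \in T then 0 else 'X_[toric_exp i].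

Definition toric : S -> S := mmap (@mpolyC _ K) toric_var.

HB.instance Definition _ := GRing.RMorphism.on toric.

Lemma monomial_neq0 (m : exp) : ('X_[m] : S) != 0.
Proof.
by apply/eqP => /(congr1 (mcoeff m))/eqP; rewrite mcoeffX eqxx mcoeff0 oner_eq0.
Qed.

Lemma toricZ c p : toric (c *: p) = c *: toric p.
Proof. by rewrite /toric mmapZ mul_mpolyC. Qed.

Lemma split_ex v : split (ex v) = inl v :> 'I_n + 'I_n.
Proof. exact: (unsplitK (inl v)). Qed.

Lemma split_ey v : split (ey v) = inr v :> 'I_n + 'I_n.
Proof. exact: (unsplitK (inr v)). Qed.

Lemma toric_x v :
  toric (x v) = if v \in T then 0 else y v * x (r v).
Proof.
by rewrite /toric mmapX mmap1U /toric_var /toric_exp /vertex split_ex mpolyXD.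
Qed.

Lemma toric_y v : toric (y v) = if v \in T then 0 else y v.
Proof. by rewrite /toric mmapX mmap1U /toric_var /toric_exp /vertex split_ey. Qed.

Definition toric_mon (m : exp) : exp :=
  (\big[mnm_add/0%MM]_(i < n + n) (toric_exp i *+ m i))%MM.

(** The monomials that do not involve the variables of T, which the
parametrization sends to 0. *)
Definition avoids (m : exp) := [forall i, (vertex i \in T) ==> (m i == 0%N)].

Lemma toric_monomial m :
  toric 'X_[m] = if avoids m then 'X_[toric_mon m] else 0.
Proof.
rewrite /toric mmapX /mmap1; case: ifPn => [/forallP hm|].
  rewrite /toric_mon (big_morph _ (@mpolyXD _ K) (@mpolyX0 _ K)); apply: eq_bigr => i _.
  rewrite /toric_var; case: ifP => iT; last by rewrite mpolyXn.
  by move/implyP: (hm i) => /(_ iT)/eqP->; rewrite expr0 mulm0n mpolyX0.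
rewrite negb_forall => /existsP[i]; rewrite negb_imply => /andP[iT mi].
by rewrite (bigD1 i) //= /toric_var iT expr0n (negPf mi) mul0r.
Qed.

Lemma toric_mon_y m v : toric_mon m (ey v) = (m (ex v) + m (ey v))%N.
Proof.

rewrite /toric_mon mnm_sumE big_split_ord /=.
rewrite (bigD1 v) //= [X in (X + _)%N](_ : _ = m (ex v)); last first.
  rewrite big1 => [|w /negPf wv].
    by rewrite mulmnE /toric_exp split_ex mnmDE !mnm1E eqxx eq_lrshift mul1n addn0.
  by rewrite mulmnE /toric_exp split_ex mnmDE !mnm1E eq_rshift wv eq_lrshift.
rewrite (bigD1 v) //= big1 => [|w /negPf wv].
  by rewrite mulmnE /toric_exp split_ey mnm1E eqxx mul1n addn0.
by rewrite mulmnE /toric_exp split_ey mnm1E eq_rshift wv.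
Qed.

Lemma toric_mon_x m c :
  toric_mon m (ex c) = (\sum_(v | r v == c) m (ex v))%N.
Proof.
rewrite /toric_mon mnm_sumE big_split_ord /= [X in (_ + X)%N]big1 => [|w _]; last first.
  by rewrite mulmnE /toric_exp split_ey mnm1E eq_rlshift.
rewrite addn0 [RHS]big_mkcond; apply: eq_bigr => v _.
rewrite mulmnE /toric_exp split_ex mnmDE !mnm1E eq_rlshift eq_lshift add0n.
by case: eqP => _; rewrite ?mul1n.
Qed.

Lemma toric_monD m m' : toric_mon (m + m') = (toric_mon m + toric_mon m')%MM.
Proof.
apply/mnmP => i; rewrite -[i]splitK; case: (split i) => v /=.
  by rewrite mnmDE !toric_mon_x -big_split; apply: eq_bigr => w _; rewrite mnmDE.
by rewrite mnmDE !toric_mon_y !mnmDE addnACA.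
Qed.

Lemma toric_mon_swap v w : r v = r w ->
  toric_mon (U_(ex v) + U_(ey w)) = toric_mon (U_(ex w) + U_(ey v)).
Proof.
move=> rvw; rewrite !toric_monD; apply/mnmP => i; rewrite -[i]splitK.
case: (split i) => u /=; rewrite !mnmDE ?toric_mon_x ?toric_mon_y.
  have sum_ex a : (\sum_(b | r b == u) U_(ex a)%MM (ex b) = (r a == u))%N.
    under eq_bigr do rewrite mnm1E eq_lshift.
    have [ra|ra] := boolP (r a == u).
      rewrite (bigD1 a) //= eqxx big1 ?addn0 // => b /andP[_ /negPf].
      by rewrite eq_sym => ->.
    by rewrite big1 // => b rb; case: eqP => // ab; move: ra; rewrite ab rb.
  have sum_ey a : (\sum_(b | r b == u) U_(ey a)%MM (ex b) = 0)%N.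
    by rewrite big1 // => b _; rewrite mnm1E eq_rlshift.
  by rewrite !sum_ex !sum_ey rvw.
rewrite !mnm1E !eq_lrshift !eq_rlshift !eq_rshift !addn0 !add0n.
exact: addnC.
Qed.

Variable e : rel 'I_n.
Hypothesis her : forall i j, i \notin T -> j \notin T -> e i j = (r i == r j).

Lemma avoids_notin m i : avoids m -> m i != 0%N -> vertex i \notin T.
Proof. by move=> /forallP/(_ i)/implyP hm; apply: contra => /hm. Qed.

Lemma avoidsD m m' : avoids (m + m') = avoids m && avoids m'.
Proof.
apply/forallP/andP => [h|[/forallP h /forallP h'] i].
  split; apply/forallP => i; apply/implyP => iT; move/implyP: (h i) => /(_ iT);
    by rewrite mnmDE addn_eq0 => /andP[].
apply/implyP => iT; rewrite mnmDE addn_eq0.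
by rewrite (implyP (h i) iT) (implyP (h' i) iT).
Qed.

Lemma vertex_ex v : vertex (ex v) = v. Proof. by rewrite /vertex split_ex. Qed.
Lemma vertex_ey v : vertex (ey v) = v. Proof. by rewrite /vertex split_ey. Qed.

Lemma mnm_splitU (m : exp) i : m i != 0%N -> m = (U_(i) + (m - U_(i)))%MM.
Proof. by move=> mi; rewrite addmC submK // lep1mP. Qed.

(** If the image of a monomial m involves x_(r v) and y_v, then m contains x_v, or
it contains y_v and some x_w with w in the block of v; exchanging x_w y_v for
x_v y_w, which are congruent modulo f_vw, brings x_v into m. *)
Lemma toric_exchange m v : avoids m -> v \notin T ->
    (0 < toric_mon m (ex (r v)))%N -> (0 < toric_mon m (ey v))%N ->
  exists m', [/\ block_ideal T e ('X_[m] - 'X_[U_(ex v) + m']),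
    avoids (U_(ex v) + m') & toric_mon (U_(ex v) + m') = toric_mon m].
Proof.
move=> am vT; rewrite toric_mon_x toric_mon_y => hx hy.
have [mv|mv] := boolP (m (ex v) == 0%N); last first.
  exists (m - U_(ex v))%MM; rewrite -mnm_splitU //; split=> //.
  by rewrite subrr; apply: ideal0.
move: hy; rewrite (eqP mv) add0n lt0n => hy.
have [w /eqP rw mw] : exists2 w, r w == r v & m (ex w) != 0%N.
  move: hx; rewrite lt0n sum_nat_eq0 negb_forall => /existsP[w].
  by rewrite negb_imply => /andP[rw mw]; exists w.
have wT : w \notin T by rewrite -(vertex_ex w); apply: avoids_notin mw.
have := mnm_splitU mw; set m1 := (m - _)%MM => Em.
have m1v : m1 (ey v) != 0%N.
  by rewrite /m1 mnmBE mnm1E eq_lrshift subn0.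
move: Em; rewrite (mnm_splitU m1v); set m2 := (m1 - _)%MM => Em.
exists (U_(ey w) + m2)%MM; rewrite Em !addmA; split.
- rewrite !mpolyXD -mulrBl mulrC; apply: idealMl => //.
  by rewrite -/(x w) -/(y v) -/(fbin K w v); apply: block_f; rewrite her // rw.
- move: am; rewrite Em !avoidsD => /and3P[_ _ ->]; rewrite andbT.
  apply/andP; split; apply/forallP => i; apply/implyP; rewrite mnm1E;
    by case: (_ =P i) => // <-; rewrite ?vertex_ex ?vertex_ey ?(negPf vT) ?(negPf wT).
- by rewrite toric_monD (toric_mon_swap (esym rw)) -toric_monD.
Qed.

(** Monomials with the same image are congruent: a variable x_v of the first can
be brought into the second by an exchange and then cancelled from both, and a
monomial without x-variables is determined by its image. *)
Lemma toric_fibre m m' : avoids m -> avoids m' -> toric_mon m = toric_mon m' ->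
  block_ideal T e ('X_[m] - 'X_[m']).
Proof.
elim: {m}_.+1 {-2}m (ltnSn (mdeg m)) m' => // d IHd m; rewrite ltnS => md m' am am' E.
have [/existsP[v mv]|] := boolP [exists v, m (ex v) != 0%N]; last first.
  (* Neither monomial has x-variables: the y-exponents agree. *)
  rewrite negb_exists => /forallP m0; have {}m0 v : m (ex v) = 0%N.
    by have := m0 v; rewrite negbK => /eqP.
  have m'0 v : m' (ex v) = 0%N.
    have := congr1 (fun k : exp => k (ex (r v))) E.
    rewrite !toric_mon_x big1 // => /esym/eqP.
    by rewrite sum_nat_eq0 => /forallP/(_ v); rewrite eqxx => /eqP.
  suff -> : m = m' by rewrite subrr; apply: ideal0.
  apply/mnmP => i; rewrite -[i]splitK; case: (split i) => v /=; first by rewrite m0.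
  have := congr1 (fun k : exp => k (ey v)) E.
  by rewrite !toric_mon_y m0 m'0.
have vT : v \notin T by rewrite -(vertex_ex v); apply: avoids_notin mv.
have [] := @toric_exchange m' v am' vT.
- by rewrite -E toric_mon_x (bigD1 v) //= ltn_addr // lt0n.
- by rewrite -E toric_mon_y ltn_addr // lt0n.
move=> m1 [hm1 am1 E1]; have Em := mnm_splitU mv.
rewrite -[_ - _](subrKA 'X_[U_(ex v) + m1]) addrC.
apply: idealD => //; first by rewrite -opprB; apply: idealN.
rewrite {1}Em !mpolyXD -mulrBr; apply: idealMl => //; apply: IHd.
- have := congr1 mdeg Em; rewrite mdegD mdeg1 => Ed.
  by rewrite Ed add1n in md.
- by move: am; rewrite {1}Em avoidsD => /andP[].
- by move: am1; rewrite avoidsD => /andP[].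
- apply: (@addmI _ (toric_mon U_(ex v))).
  by rewrite -!toric_monD -Em E E1.
Qed.

Lemma toric_block p : block_ideal T e p -> toric p = 0.
Proof.
pose I : set S := fun p => toric p = 0; suff: (block_ideal T e `<=` I)%classic by apply.
apply: block_sub.
- split; first exact: rmorph0.
    by move=> a b; rewrite /I rmorphD /= => -> ->; rewrite addr0.
  by move=> c a; rewrite /I rmorphM /= => ->; rewrite mulr0.
- by move=> v vT; rewrite /I toric_x toric_y vT.
move=> i j iT jT eij; rewrite /I /fbin rmorphB !rmorphM /= !toric_x !toric_y.
rewrite (negPf iT) (negPf jT); move: eij; rewrite her // => /eqP->.
by rewrite [y i * _ * _]mulrAC [y j * _ * _]mulrAC [y i * y j]mulrC subrr.
Qed.

(** A choice of one monomial in each fibre; it makes the parametrization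
injective on the span of the chosen monomials. *)
Definition fibre_rep (m : exp) : exp :=
  choose (fun m' => avoids m' && (toric_mon m' == toric_mon m)) m.

(** Replacing each monomial of p by the representative of its fibre changes p
only by an element of the ideal, and the coefficients of the result are
those of the image of p. *)
Lemma toric_kernel p : toric p = 0 -> block_ideal T e p.
Proof.
move=> tp0.
have repP m : avoids m ->
    avoids (fibre_rep m) /\ toric_mon (fibre_rep m) = toric_mon m.
  move=> am; apply/(andPP idP eqP); rewrite /fibre_rep.
  by apply: (@chooseP _ (fun m' => avoids m' && (toric_mon m' == toric_mon m)));
    rewrite am eqxx.
have rep_eq m m' : avoids m -> avoids m' ->
    (fibre_rep m == fibre_rep m') = (toric_mon m == toric_mon m').
  move=> am am'; apply/eqP/eqP => [E|E].
    by rewrite -(repP m am).2 E (repP m' am').2.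
  rewrite /fibre_rep E; apply: choose_id; rewrite ?am ?am' ?E ?eqxx //.
pose p' : S := \sum_(m <- msupp p | avoids m) p@_m *: 'X_[fibre_rep m].
suff p'0 : p' = 0.
  rewrite -[p]subr0 -p'0 {1}[p]mpolyE (bigID avoids) /= addrAC -sumrB.
  apply: idealD => //; apply: ideal_big => // m am.
    rewrite -scalerBr -mul_mpolyC; apply: idealMl => //.
    by have [am1 E] := repP m am; apply: toric_fibre.
  rewrite -mul_mpolyC; apply: idealMl => //.
  move: am; rewrite negb_forall => /existsP[i]; rewrite negb_imply => /andP[iT mi].
  rewrite (mnm_splitU mi) mpolyXD mulrC; apply: idealMl => //.
  by move: iT; rewrite -[i]splitK /vertex unsplitK; case: (split i) => v /= vT;
    [apply: block_x|apply: block_y].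
apply/mpolyP => k; rewrite mcoeff0 raddf_sum /=.
have [/hasP[m0 _ /andP[am0 /eqP km0]]|/hasPn nk] :=
    boolP (has (fun m => avoids m && (fibre_rep m == k)) (msupp p)); last first.
  rewrite big_seq_cond big1 // => m /andP[mp am]; rewrite mcoeffZ mcoeffX.
  by have := nk m mp; rewrite am /= => /negPf->; rewrite mulr0.
rewrite -[RHS](_ : (toric p)@_(toric_mon m0) = 0); last by rewrite tp0 mcoeff0.
rewrite [in RHS](mpolyE p) [toric _]raddf_sum /= raddf_sum /= [LHS]big_mkcond.
apply: eq_bigr => m _.
rewrite toricZ toric_monomial mcoeffZ.
case: ifP => am; last by rewrite mcoeff0 mulr0.
by rewrite mcoeffZ !mcoeffX -km0 rep_eq.
Qed.

Lemma block_toricE p : block_ideal T e p <-> toric p = 0.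
Proof. by split; [apply: toric_block|apply: toric_kernel]. Qed.

Lemma block_x_toric v : block_ideal T e (x v) -> v \in T.
Proof.
move/toric_block; rewrite toric_x; case: ifP => // _ /eqP.
by rewrite mulf_eq0 !(negPf (monomial_neq0 _)).
Qed.

Lemma block_prime_toric : is_prime (block_ideal T e).
Proof.
split=> //.
  by move/block_toricE; rewrite rmorph1 => /eqP; rewrite oner_eq0.
move=> a b /block_toricE; rewrite rmorphM => /eqP; rewrite mulf_eq0.
by case/orP => /eqP h; [left|right]; apply/block_toricE.
Qed.

Lemma block_f_toric i j : i \notin T -> j \notin T ->
  block_ideal T e (f i j) -> e i j.
Proof.
move=> iT jT /toric_block; rewrite /fbin rmorphB !rmorphM /= !toric_x !toric_y.
rewrite (negPf iT) (negPf jT) [y i * _ * _]mulrAC [y j * _ * _]mulrAC [y j * y i]mulrC.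
rewrite -mulrBr her //.
move/eqP; rewrite !mulf_eq0 !(negPf (monomial_neq0 _)) /= subr_eq0.
move/eqP/(congr1 (mcoeff U_(ex (r i)))).
rewrite !mcoeffX eqxx eq_mnm1 eq_lshift eq_sym; case: eqP => // _ /eqP.
by rewrite oner_eq0.
Qed.

End Toric.

End BlockIdeals.

(** * Cohomology in degree one of an order complex *)

Section DegreeOne.
Local Open Scope classical_set_scope.
Local Open Scope ring_scope.
Variables (X : Type) (lt : X -> X -> Prop) (K : fieldType).
Hypothesis lt_trans : forall a b c, lt a b -> lt b c -> lt a c.
Hypothesis lt_irr : forall a, ~ lt a a.
Implicit Type P : set X.

Lemma linkC P a b : clos_refl_trans X (skeleton_adj lt P) a b ->
  clos_refl_trans X (skeleton_adj lt P) b a.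
Proof.
elim=> {a b} [a b [Pa Pb ab]|a|a b c _ ba _ cb]; last exact: rt_trans cb ba.
  by apply: rt_step; split=> //; case: ab; [right|left].
exact: rt_refl.
Qed.

(** In degree one the chains and cochains of the order complex unfold to
functions of two comparable elements: a cocycle is an additive function on
comparable pairs, a coboundary the difference of a potential. *)
Lemma reduced_cohomology1E P :
  reduced_cohomology_eq0 lt K P 1 <->
  forall F : X -> X -> K,
    (forall a b c, P a -> P b -> P c -> lt a b -> lt b c ->
       F a c = F a b + F b c) ->
  exists g : X -> K, forall a b, P a -> P b -> lt a b -> F a b = g b - g a.
Proof.
pose pair (a b : X) : 'I_2 -> X := fun i => if i == 0 :> nat then a else b.
have pairE (s : 'I_2 -> X) : s = pair (s ord0) (s ord_max).
  by apply: funext => -[[|[|]]] // i; rewrite /pair /=; congr s; apply: val_inj.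
pose triple (a b c : X) : 'I_3 -> X :=
  fun i => if i == 0 :> nat then a else if i == 1 :> nat then b else c.
have dpair (F : cochain X K 1) (s : 'I_2 -> X) :
    coboundary F s = F (fun=> s ord_max) - F (fun=> s ord0).
  rewrite /coboundary big_ord_recl big_ord1 expr0 mul1r expr1 mulN1r.
  by congr (F _ - F _); apply: funext => i; congr s; apply: val_inj;
    rewrite (ord1 i).
have dtriple (F : cochain X K 2) (s : 'I_3 -> X) :
    coboundary F s = F (pair (s (inord 1)) (s (inord 2)))
      - F (pair (s (inord 0)) (s (inord 2))) + F (pair (s (inord 0)) (s (inord 1))).
  rewrite /coboundary !big_ord_recl big_ord0 addr0 expr0 mul1r expr1 mulN1r.
  rewrite sqrrN expr1n mul1r addrA.
  by congr (F _ - F _ + F _); rewrite [LHS]pairE; congr pair; congr s;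
    apply: val_inj; rewrite /= inordK.
have Ptriple a b c : P a -> P b -> P c -> lt a b -> lt b c ->
    order_simplex lt P (triple a b c).
  move=> Pa Pb Pc ab bc; split; first by move=> [[|[|[|]]]].
  by move=> [[|[|[|]]]] // ? [[|[|[|]]]] // ? _; rewrite /triple //=;
    apply: lt_trans bc.
split=> [H F hF|H F hF].
  have [|g hg] := H (fun s => F (s ord0) (s ord_max)).
    move=> s [Ps lts]; rewrite dtriple /pair /=.
    have lts01 : lt (s (inord 0)) (s (inord 1)) by apply: lts; rewrite !inordK.
    have lts12 : lt (s (inord 1)) (s (inord 2)) by apply: lts; rewrite !inordK.
    by rewrite (hF _ _ _ _ _ _ lts01 lts12) //; ring.
  exists (fun a => g (fun=> a)) => a b Pa Pb ab.
  rewrite -(dpair _ (pair a b)) -hg //; split; first by move=> [[|[|]]].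
  by move=> [[|[|]]] // ? [[|[|]]].
have [|g hg] := H (fun a b => F (pair a b)).
  move=> a b c Pa Pb Pc ab bc; have := hF _ (Ptriple _ _ _ Pa Pb Pc ab bc).
  rewrite dtriple /triple !inordK //= => /eqP; rewrite addrAC subr_eq0 => /eqP <-.
  by rewrite addrC.
exists (fun s => g (s ord0)) => s [Ps lts].
by rewrite dpair /= [s]pairE hg //; apply: lts.
Qed.

(** A part Q of the poset such that every z in Q satisfies c z <= z and
c z <= c0, with c monotone, is contractible. *)
Section Cone.
Variables (P Q : set X) (c : X -> X) (c0 : X).
Local Notation le a b := (lt a b \/ a = b).
Hypothesis QP : Q `<=` P.
Hypothesis cQ : forall z, Q z -> [/\ Q (c z), Q c0, le (c z) z & le (c z) c0].
Hypothesis c_mono : forall y z, Q y -> Q z -> lt y z -> le (c y) (c z).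

(** The value of the potential at z is the integral of F along the path from c0
down to c z and up to z. *)
Lemma cone_potential (F : X -> X -> K) :
    (forall a b d, P a -> P b -> P d -> lt a b -> lt b d ->
       F a d = F a b + F b d) ->
  exists g : X -> K, forall a b, Q a -> Q b -> lt a b -> F a b = g b - g a.
Proof.
move=> hF; pose F' a b := if `[< lt a b >] then F a b else 0.
have F'E a b : lt a b -> F' a b = F a b by move=> ab; rewrite /F' asboolT.
have F'0 a : F' a a = 0 by rewrite /F' asboolF //; apply: lt_irr.
have hF' a b d : Q a -> Q b -> Q d -> le a b -> le b d -> F' a d = F' a b + F' b d.
  move=> Qa Qb Qd [ab|->]; last by rewrite F'0 add0r.
  case=> [bd|<-]; last by rewrite F'0 addr0.
  by rewrite !F'E //; [apply: hF; rewrite //; apply: QP|apply: lt_trans bd].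
exists (fun z => F' (c z) z - F' (c z) c0) => a b Qa Qb ab; rewrite -F'E //.
have [Qca Qc0 ca_a ca_c0] := cQ Qa; have [Qcb _ cb_b cb_c0] := cQ Qb.
have cab := c_mono Qa Qb ab.
have E1 : F' (c a) a + F' a b = F' (c a) (c b) + F' (c b) b.
  by rewrite -!hF' //; left.
have -> : F' a b = F' (c a) (c b) + F' (c b) b - F' (c a) a by rewrite -E1 addrC addKr.
by rewrite (hF' (c a) (c b) c0) //; ring.
Qed.

Lemma cone_cohomology1 : P `<=` Q -> reduced_cohomology_eq0 lt K P 1.
Proof.
move=> PQ; apply/reduced_cohomology1E => F /cone_potential[g hg].
by exists g => a b /PQ Qa /PQ Qb; apply: hg.
Qed.

Lemma cone_constant (g : X -> K) :
    (forall a b, Q a -> Q b -> lt a b -> g a = g b) ->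
  forall a, Q a -> g a = g c0.
Proof.
move=> hg a Qa; have [Qca Qc0 ca_a ca_c0] := cQ Qa.
have le_eq b d : Q b -> Q d -> le b d -> g b = g d.
  by move=> Qb Qd [/hg->|->].
by rewrite -(le_eq (c a) a) // (le_eq (c a) c0).
Qed.

(** When P is the cone Q with a minimal point m added, a class in degree 1 is
measured by how a potential on Q varies, relative to F m, on the elements above
m: it vanishes if these form a connected set, and the indicator of a connected
component gives a nontrivial cocycle otherwise. *)
Lemma suspension_cohomology1 m :
    P m -> ~ Q m -> (forall z, P z -> z = m \/ Q z) -> (forall z, P z -> ~ lt z m) ->
  reduced_cohomology_eq0 lt K P 1 <-> poset_connected lt [set z | P z /\ lt m z].
Proof.
move=> Pm nQm PQ min_m; set L := [set z | _].
have LQ z : L z -> Q z.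
  by move=> [Pz mz]; case: (PQ z Pz) => // zm; case: (@lt_irr m); rewrite -{2}zm.
split=> [/reduced_cohomology1E H a b La Lb|Lconn].
  apply: contrapT => nab.
  (* The indicator of the edges from m to the component of a. *)
  pose F d z : K := if `[< d = m /\ clos_refl_trans X (skeleton_adj lt L) a z >]
                    then 1 else 0.
  have [|g hg] := H F.
    move=> d z t Pd Pz Pt dz zt.
    have -> : F z t = 0.
      by rewrite /F asboolF // => -[zm _]; apply: (min_m d Pd); rewrite -zm.
    rewrite addr0 /F; congr (if _ then _ else _); apply: asbool_equiv_eq.
    split=> -[dm az]; split=> //; apply: rt_trans az _; apply: rt_step.
      split; [split=> //|split=> //|by right].
        by rewrite -dm; apply: lt_trans zt.
      by rewrite -dm.
    split; [split=> //|split=> //|by left].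
      by rewrite -dm.
    by rewrite -dm; apply: lt_trans zt.
  have gc : forall z, Q z -> g z = g c0.
    apply: cone_constant => y z Qy Qz yz; apply/esym/eqP; rewrite -subr_eq0.
    have [Py Pz] : P y /\ P z by split; apply: QP.
    rewrite -hg //.
    by rewrite /F asboolF // => -[ym _]; apply: nQm; rewrite -ym.
  have Fab : F m a = F m b.
    case: La Lb (LQ a La) (LQ b Lb) => Pa ma [Pb mb] Qa Qb.
    by rewrite !hg // (gc a) // (gc b).
  move: Fab; rewrite /F asboolT; last by split=> //; apply: rt_refl.
  rewrite asboolF; last by case.
  by move/eqP; rewrite oner_eq0.
apply/reduced_cohomology1E => F hF; have [g hg] := cone_potential hF.
have [gm hgm] : exists gm, forall z, L z -> g z - F m z = gm.
  have [[a La]|noL] := pselect (exists a, L a); last first.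
    by exists 0 => z Lz; case: noL; exists z.
  exists (g a - F m a) => z Lz; elim: (Lconn z a Lz La) => {z Lz}.
  - have step b d : L b -> L d -> lt b d -> g b - F m b = g d - F m d.
      move=> Lb Ld bd; have Ebd := hg b d (LQ _ Lb) (LQ _ Ld) bd.
      have Emd := hF m b d Pm Lb.1 Ld.1 Lb.2 bd.
      by rewrite Emd Ebd; ring.
    by move=> b d [Lb Ld [bd|db]]; [apply: step|apply/esym/step].
  - by [].
  - by move=> b d t _ -> _ ->.
(* The potential at m is the constant value of g - F m on L. *)
exists (fun z => if `[< z = m >] then gm else g z) => y z Py Pz yz.
have zm : z <> m by move=> zm; apply: (min_m y Py); rewrite -zm.
rewrite [in `[< z = m >]]asboolF //.
case: (pselect (y = m)) => ym.
  rewrite ym asboolT // -(hgm z); last by split=> //; rewrite -ym.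
  by ring.
rewrite asboolF //; apply: hg => //; first by case: (PQ y Py).
by case: (PQ z Pz).
Qed.

End Cone.
End DegreeOne.

(** * Ideals in the construction of the poset *)

Section Stages.
Local Open Scope ring_scope.
Variables (K : fieldType) (n : nat).
Local Notation S := {mpoly K[n + n]}.
Local Notation x := (@xvar K n).
Local Notation y := (@yvar K n).
Local Notation f := (@fbin K n).
Local Notation block := (@block_ideal K n).
Implicit Types (G H : sgraph n) (T U W : {set 'I_n}) (I J : set S).
Local Hint Resolve block_ideal_ideal : core.

Lemma deletion_sym G T : ssrbool.symmetric (deletion G T).
Proof. by move=> i j; rewrite /deletion /= adj_sym andbCA. Qed.

Lemma deletion_connect_sym G T : connect_sym (deletion G T).
Proof. exact/sym_connect_sym/deletion_sym. Qed.

Lemma deletion_connect_mono G T U i j : T \subset U ->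
  connect (deletion G U) i j -> connect (deletion G T) i j.
Proof.
move=> /fintype.subsetP TU; apply: connect_sub => {i j} i j /and3P[iU jU Gij].
by apply: connect1; rewrite /deletion /= Gij (contra (TU i)) ?(contra (TU j)).
Qed.

(** The roots of the components serve as representatives of the blocks. *)
Lemma block_connect_prime T (e : rel 'I_n) :
  connect_sym e -> is_prime (block T (connect e)).
Proof.
move=> se; apply: (@block_prime_toric K n T (fingraph.root e) (connect e)) => i j _ _.
by rewrite root_connect.
Qed.

Lemma block_connect_x T (e : rel 'I_n) v : connect_sym e ->
  block T (connect e) (x v) -> v \in T.
Proof.
move=> se; apply: (@block_x_toric K n T (fingraph.root e) (connect e)) => i j _ _.
by rewrite root_connect.
Qed.

Lemma block_eq_f T i j : i \notin T -> j \notin T ->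
  block T eq_op (f i j) -> i = j.
Proof. by move=> iT jT h; apply/eqP; apply: (@block_f_toric K n T id eq_op) h. Qed.

Lemma block_eq_x T v : block T eq_op (x v) -> v \in T.
Proof. exact: (@block_x_toric K n T id eq_op). Qed.

Lemma P_idealE T H : @P_ideal K n T H = block T (connect (deletion H T)).
Proof.
have hB (C : {set 'I_n}) : is_ideal (@binomial_edge_ideal K n (complete_on C)).
  exact: ideal_gen_ideal.
have hV : is_ideal (@variable_ideal K n T) by exact: ideal_gen_ideal.
have hS : is_ideal (ideal_sum (components H T)
    (fun C => @binomial_edge_ideal K n (complete_on C))).
  by apply: ideal_sum_ideal.
apply/seteqP; split.
  apply: ideal_add_min => //.
    apply: ideal_gen_min => // p [v vT [->|->]]; first exact: block_x.
    exact: block_y.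
  apply: ideal_sum_min => // C /imsetP[a _ ->].
  apply: ideal_gen_min => // p [i [j [_ /and3P[]]]].
  rewrite !inE => /andP[_ ai] /andP[_ aj] _ ->; apply: block_f.
  by apply: connect_trans aj; rewrite deletion_connect_sym.
have hA := ideal_add_ideal hV hS.
apply: block_sub => // [v vT|i j iT jT ij].
  by split; apply: ideal_add_subl => //; apply: mem_ideal_gen; exists v => //;
    [left|right].
apply: ideal_add_subr => //.
have [<-|nij] := eqVneq i j; first by rewrite fbinxx; apply: ideal0.
pose C := [set k in ~: T | connect (deletion H T) i k]%SET.
have CH : C \in components H T by apply: imset_f; rewrite inE.
have iC : i \in C by rewrite !inE iT connect0.
have jC : j \in C by rewrite !inE jT ij.
apply: (ideal_sum_sub _ CH) => //.
have [lt_ij|] := ltnP i j.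
  by apply: mem_ideal_gen; exists i, j; split=> //; apply/and3P.
rewrite leq_eqVlt => /orP[/eqP/val_inj ji|lt_ji]; first by rewrite ji eqxx in nij.
rewrite fbin_sym; apply: idealN => //.
by apply: mem_ideal_gen; exists j, i; split=> //; apply/and3P; rewrite eq_sym.
Qed.

Definition vset I : {set 'I_n} := finset (fun v => `[< I (x v) /\ I (y v) >]).

Lemma vsetP I v : v \in vset I <-> I (x v) /\ I (y v).
Proof. by rewrite inE; split=> /asboolP. Qed.

Lemma vset_mono I J : (I `<=` J)%classic -> vset I \subset vset J.
Proof.
move=> IJ; apply/fintype.subsetP => v /vsetP[Ix Iy].
by apply/vsetP; split; apply: IJ.
Qed.

(** A prime that contains f_ia and f_aj but not both x_a and y_a contains f_ij. *)
Lemma prime_path (p : set S) (e : rel 'I_n) : is_prime p ->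
    (forall i j, e i j -> p (f i j) /\ i \notin vset p) ->
  forall i j, connect e i j -> p (f i j).
Proof.
move=> [pI _ pM] he i j /connectP[s]; elim: s i => [|a s IHs] i /=.
  by move=> _ ->; rewrite fbinxx; apply: ideal0.
move=> /andP[ia as_] Ej; have paj := IHs a as_ Ej; have [pia _] := he i a ia.
case: s as_ Ej {IHs} => [_ ->//|b s /= /andP[ab _] _].
have [_ aV] := he a b ab.
have hx : p (x a * f i j).
  have -> : x a * f i j = x i * f a j + x j * f i a by rewrite /fbin; ring.
  by apply: idealD => //; apply: idealMl.
have hy : p (y a * f i j).
  have -> : y a * f i j = y i * f a j + y j * f i a by rewrite /fbin; ring.
  by apply: idealD => //; apply: idealMl.
have [pxa|//] := pM _ _ hx; have [pya|//] := pM _ _ hy.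
by case/negP: aV; apply/vsetP.
Qed.

Lemma prime_component (p : set S) G : is_prime p ->
    (forall i j, G i j -> p (f i j)) ->
  forall i j, connect (deletion G (vset p)) i j -> p (f i j).
Proof.
move=> hp hG; apply: prime_path => // i j /and3P[iV _ Gij].
by split; first exact: hG.
Qed.

(** The part of an ideal generated by the variables of its vertices and by its
binomials f_ij with i, j in one component of G. It is monotone in the ideal,
which is what makes it compatible with arbitrary sums. *)
Definition span G I : set S :=
  block (vset I) (fun i j => `[< I (f i j) >] && connect G i j).

Lemma span_ideal G I : is_ideal (span G I).
Proof. exact: block_ideal_ideal. Qed.
Local Hint Resolve span_ideal : core.

Lemma span_mono G I J : (I `<=` J)%classic -> (span G I `<=` span G J)%classic.
Proof.
move=> IJ; apply: block_mono; first exact: vset_mono.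
by move=> i j _ _ /andP[/asboolP Iij ->]; rewrite andbT; apply/asboolP/IJ.
Qed.

Lemma span_sub G I : is_ideal I -> (span G I `<=` I)%classic.
Proof.
by move=> hI; apply: block_sub => // [v /vsetP//|i j _ _ /andP[/asboolP]].
Qed.

Lemma graph_connect_sym G : connect_sym G.
Proof. exact/sym_connect_sym/adj_sym. Qed.

(** For a prime p, the vertices i, j outside its vertex set with f_ij in p are
related by an equivalence, by [prime_path]. *)
Lemma span_prime G p : is_prime p -> is_prime (span G p).
Proof.
move=> hp; have [pI _ _] := hp.
pose e := [rel i j | [&& i \notin vset p, j \notin vset p,
                         `[< p (f i j) >] & connect G i j]].
have e_sym : ssrbool.symmetric e.
  have half i j : e i j -> e j i.
    move=> /and4P[iV jV /asboolP pij Gij]; apply/and4P; split=> //.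
      by apply/asboolP; rewrite fbin_sym; apply: idealN.
    by rewrite graph_connect_sym.
  by move=> i j; apply/idP/idP; apply: half.
suff -> : span G p = block (vset p) (connect e).
  exact/block_connect_prime/sym_connect_sym.
apply: eq_block => i j iV jV; apply/andP/idP => [[pij Gij]|ij].
  by apply: connect1; apply/and4P.
split.
  apply/asboolP; apply: prime_path ij => // a b /and4P[aV _ /asboolP pab _].
  by split.
by apply: connect_sub ij => a b /and4P[].
Qed.

Definition spanned G I : Prop :=
  [/\ is_ideal I, forall i j, G i j -> I (f i j) & (I `<=` span G I)%classic].

Lemma spanned_P_ideal G T : spanned G (@P_ideal K n T G).
Proof.
rewrite P_idealE; split=> // [i j Gij|].
  have [iT|iT] := boolP (i \in T).
    by apply: fbin_vars => //; [apply: block_x|apply: block_y].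
  have [jT|jT] := boolP (j \in T).
    rewrite fbin_sym; apply: idealN => //.
    by apply: fbin_vars => //; [apply: block_x|apply: block_y].
  by apply/block_f/connect1; rewrite /deletion /= iT jT.
apply: block_mono.
  by apply/fintype.subsetP => v vT; apply/vsetP; split; [apply: block_x|apply: block_y].
move=> i j _ _ ij; apply/andP; split; first exact/asboolP/block_f.
by apply: connect_sub ij => a b /and3P[_ _ Gab]; apply: connect1.
Qed.

Lemma spanned_sum G k (q : 'I_k.+1 -> set S) :
  (forall i, spanned G (q i)) -> spanned G (ideal_sum [set: 'I_k.+1] q).
Proof.
move=> hq; have qI i : i \in [set: 'I_k.+1] -> is_ideal (q i) by case: (hq i).
split; first exact: ideal_sum_ideal.
  move=> i j Gij; apply: (ideal_sum_sub qI (finset.in_setT ord0)).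
  by have [_ + _] := hq ord0; apply.
apply: ideal_sum_min => // i iT; have [_ _ qi] := hq i.
apply: subset_trans qi _; apply: span_mono; exact: ideal_sum_sub.
Qed.

Lemma spanned_add G I J :
  spanned G I -> spanned G J -> spanned G (ideal_add I J).
Proof.
move=> [hI GI IG] [hJ GJ JG]; split; first exact: ideal_add_ideal.
  by move=> i j Gij; apply: ideal_add_subl => //; apply: GI.
apply: ideal_add_min => //.
  by apply: subset_trans IG _; apply: span_mono; apply: ideal_add_subl.
by apply: subset_trans JG _; apply: span_mono; apply: ideal_add_subr.
Qed.

(** The span of p is a prime between I and p, hence equals p by minimality. *)
Lemma spanned_minimal_prime G I p :
  spanned G I -> minimal_prime I p -> spanned G p.
Proof.
move=> [hI GI IG] [hp Ip pmin]; have [pI _ _] := hp.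
split=> //; first by move=> i j Gij; apply/Ip/GI.
rewrite -{1}(pmin (span G p)) //; first exact: span_prime.
- by apply: subset_trans IG _; apply: span_mono.
- exact: span_sub.
Qed.

(** The invariant of the recursive construction of the poset. *)
Lemma spanned_stage G I : MG_stage G I -> spanned G I.
Proof.
elim=> {I} [I [k [q [hq ->]]]|I J _ IG _ [k [q [hq ->]]]].
  by apply: spanned_sum => i; have [T ->] := hq i; apply: spanned_P_ideal.
apply: spanned_sum => i.
have [/(spanned_minimal_prime IG)//|[p /(spanned_minimal_prime IG) hp ->]] := hq i.
by apply: spanned_add => //; apply: spanned_P_ideal.
Qed.

Lemma MG_prime_component G z : MG_poset G z ->
  forall i j, connect (deletion G (vset z)) i j -> z (f i j).
Proof.
by move=> [/spanned_stage[_ Gz _] zp]; apply: prime_component.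
Qed.

(** For T contained in U this is the sum P_T(G) + P_U(G). *)
Definition comp_ideal G T U : set S := block U (connect (deletion G T)).

(** The sum of the ideal of the variables of U and of the ideal P_T(G) with T
empty. *)
Definition hull G U : set S := comp_ideal G finset.set0 U.

Lemma MG_sub_hull G z : MG_poset G z -> (z `<=` hull G (vset z))%classic.
Proof.
move=> [/spanned_stage[_ _ zG] _]; apply: subset_trans zG _.
apply: block_mono => // i j _ _ /andP[_].
by apply: connect_sub => a b Gab; apply: connect1; rewrite /deletion /= !inE.
Qed.

Lemma comp_ideal_sub G T U T' U' : U \subset U' -> T' \subset T ->
  (comp_ideal G T U `<=` comp_ideal G T' U')%classic.
Proof.
by move=> UU TT; apply: block_mono => // i j _ _; apply: deletion_connect_mono.
Qed.

(** The components of G - U refine those of G - T, so the sum of P_T(G) and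
P_U(G) is again generated by variables and by complete graphs on disjoint sets
of vertices. *)
Lemma comp_ideal_MG G T U : T \subset U -> MG_poset G (comp_ideal G T U).
Proof.
move=> TU; split; last exact/block_connect_prime/deletion_connect_sym.
pose q (i : 'I_2) : set S := P_ideal (if i == ord0 then T else U) G.
apply: MG_init; exists 1%N, q; split.
  by move=> i; exists (if i == ord0 then T else U).
have qI i : i \in [set: 'I_2] -> is_ideal (q i) by rewrite /q P_idealE.
apply/seteqP; split.
  have hs := ideal_sum_ideal qI.
  apply: block_sub => // [v vU|i j iU jU ij].
    split; apply: (ideal_sum_sub qI (finset.in_setT ord_max)); rewrite /q P_idealE /=;
      by [apply: block_x|apply: block_y].
  apply: (ideal_sum_sub qI (finset.in_setT ord0)).
  by rewrite /q P_idealE; apply: block_f.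
apply: ideal_sum_min => [|i _]; first exact: block_ideal_ideal.
rewrite /q P_idealE.
by case: ifP => _; apply: comp_ideal_sub.
Qed.

Lemma vset_comp_ideal G T U : vset (comp_ideal G T U) = U.
Proof.
apply/setP => v; apply/idP/idP => [/vsetP[h _]|vU].
  by apply: block_connect_x h; apply: deletion_connect_sym.
by apply/vsetP; split; [apply: block_x|apply: block_y].
Qed.

End Stages.

(** * Connectedness of the interval above an ideal of variables *)

Section PrecOrder.
Local Open Scope classical_set_scope.
Variable R : comNzRingType.
Implicit Types I J L : set R.

Lemma prec_trans I J L : prec I J -> prec J L -> prec I L.
Proof.
move=> [JI nIJ] [LJ nJL]; split; first exact: subset_trans JI.
by move=> IL; apply: nIJ; apply: subset_trans LJ.
Qed.

Lemma prec_irr I : ~ prec I I.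
Proof. exact: properxx. Qed.

Lemma sub_prec I J : J `<=` I -> prec I J \/ I = J.
Proof.
move=> JI; have [IJ|nIJ] := pselect (I `<=` J); last by left.
by right; apply/seteqP.
Qed.

End PrecOrder.

Section Interval.
Variables (K : fieldType) (n : nat) (G : sgraph n) (T : {set 'I_n}).
Variables (u w : 'I_n).
Local Notation S := {mpoly K[n + n]}.
Local Notation x := (@xvar K n).
Local Notation y := (@yvar K n).
Local Notation f := (@fbin K n).
Local Notation block := (@block_ideal K n).
Implicit Types (U V : {set 'I_n}) (z : set S).
Local Hint Resolve block_ideal_ideal : core.
Hypotheses (neq_uw : u != w) (compT : (~: T = [set u; w])%SET).

Lemma notin_uw i : i \notin T -> i = u \/ i = w.
Proof. by rewrite -finset.in_setC compT !inE => /orP[/eqP|/eqP]; [left|right]. Qed.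

Lemma u_notin : u \notin T.
Proof. by rewrite -finset.in_setC compT !inE eqxx. Qed.

Lemma w_notin : w \notin T.
Proof. by rewrite -finset.in_setC compT !inE eqxx orbT. Qed.

Definition separates U := ~~ connect (deletion G U) u w.

Local Notation mT := (block T eq_op).
Local Notation interval := (MG_interval G mT).
Local Notation link := (clos_refl_trans (set S) (skeleton_adj (@prec S) interval)).

Lemma eq_ideal_sub z : is_prime z -> T \subset vset z -> (mT `<=` z)%classic.
Proof.
move=> [zI _ _] /fintype.subsetP Tz; apply: block_sub => // [v /Tz/vsetP//|].
by move=> i j _ _ /eqP->; rewrite fbinxx; apply: ideal0.
Qed.

Lemma vset_eq_ideal z : (z `<=` mT)%classic -> vset z \subset T.
Proof.
move=> zm; apply/fintype.subsetP => v /vsetP[zv _].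
by apply: (@block_eq_x K n); apply: zm.
Qed.

Lemma comp_ideal_prec U V (e : rel 'I_n) : V \proper T ->
    (@comp_ideal K n G U V `<=` block T e)%classic ->
  prec (block T e) (@comp_ideal K n G U V).
Proof.
case/properP => _ [t tT tV] sub; apply: (proper_witness sub (block_x K e tT)).
by move/block_connect_x => /(_ (deletion_connect_sym _ _)); apply/negP.
Qed.

Lemma comp_ideal_interval U V : U \subset V -> V \proper T -> separates U ->
  interval (@comp_ideal K n G U V).
Proof.
move=> UV VT sepU; split; first exact: comp_ideal_MG.
apply: comp_ideal_prec => //; apply: block_mono; first exact: proper_sub.
move=> i j iT jT ij; apply/eqP.
move: ij; have [->|->] := notin_uw iT; have [->|->] := notin_uw jT => // ij.
  by case/negP: sepU.
by case/negP: sepU; rewrite /separates deletion_connect_sym.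
Qed.

Lemma interval_separates z : interval z ->
  vset z \proper T /\ separates (vset z).
Proof.
move=> [zM [zm nmz]]; split.
  rewrite properE vset_eq_ideal //=; apply/negP => /eq_ideal_sub mz.
  by apply: nmz; apply: mz; case: zM.
apply/negP => /(MG_prime_component zM)/zm.
by move/(block_eq_f u_notin w_notin)/eqP; apply/negP.
Qed.

Lemma link_sub z z' : interval z -> interval z' -> (z `<=` z')%classic -> link z z'.
Proof.
move=> Iz Iz' /sub_prec[zz'|->]; last exact: rt_refl.
by apply: rt_step; split=> //; right.
Qed.

(** Both ideals lie in their sum, which is in the interval because V is a proper
subset of T. The ideal of U need not be contained in that of V: a component of
G - U may break up in G - V. *)
Lemma link_comp U V : U \subset V -> V \proper T -> separates U ->
  link (@comp_ideal K n G U U) (@comp_ideal K n G V V).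
Proof.
move=> UV VT sepU.
have UT : U \proper T by apply: sub_proper_trans VT.
have sepV : separates V by apply: contra sepU; apply: deletion_connect_mono.
have IUV := comp_ideal_interval UV VT sepU.
apply: (@rt_trans _ _ _ (@comp_ideal K n G U V)); [|apply: linkC];
  by apply: link_sub => //;
    [apply: comp_ideal_interval|apply: comp_ideal_sub].
Qed.

(** The ideal P_(T-t)(G). *)
Definition corank1_ideal t := @comp_ideal K n G (T :\ t)%SET (T :\ t)%SET.

Lemma link_corank1 t t' : t \in T -> t' \in T ->
  separates (T :\: [set t; t'])%SET -> link (corank1_ideal t) (corank1_ideal t').
Proof.
move=> tT t'T sep.
pose U := (T :\: [set t; t'])%SET.
have step a : a \in T -> a \in [set t; t']%SET ->
    link (@comp_ideal K n G U U) (corank1_ideal a).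
  by move=> aT at'; apply: link_comp => //;
    [apply: finset.setDS; rewrite finset.sub1set|apply: properD1].
apply: (@rt_trans _ _ _ (@comp_ideal K n G U U)).
  by apply/linkC/step; rewrite ?inE ?eqxx.
by apply: step; rewrite ?inE ?eqxx ?orbT.
Qed.

Lemma closed_separates (C : {set 'I_n}) U : u \in C -> w \notin C ->
    (forall i j, i \in C -> j \notin U -> G i j -> j \in C) ->
  separates U.
Proof.
move=> uC wC hC; apply/negP.
have cl : closed (deletion G U) (mem C).
  apply: intro_closed; first exact: deletion_connect_sym.
  by move=> i j /and3P[_ jU Gij] iC; apply: hC Gij.
by move/(closed_connect cl); rewrite uC (negPf wC).
Qed.

Hypothesis nGuw : ~~ G u w.

Lemma notin_setD2 t t' j : j \notin (T :\: [set t; t'])%SET ->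
  [\/ j = u, j = w, j = t | j = t'].
Proof.
rewrite !inE negb_and negbK => /orP[/orP[/eqP->|/eqP->]|/notin_uw[]->];
  by [constructor 3|constructor 4|constructor 1|constructor 2].
Qed.

Lemma in_neq_uw t : t \in T -> (t != u) && (t != w).
Proof.
by move=> tT; apply/andP; split; apply/eqP => tE;
  rewrite tE ?(negPf u_notin) ?(negPf w_notin) in tT.
Qed.

Lemma link_avoid_w t t' : t \in T -> t' \in T -> ~~ G t w -> ~~ G t' w ->
  link (corank1_ideal t) (corank1_ideal t').
Proof.
move=> tT t'T ntw nt'w; apply: link_corank1 => //.
have /andP[_ tw] := in_neq_uw tT; have /andP[_ t'w] := in_neq_uw t'T.
apply: (@closed_separates [set u; t; t']%SET).
- by rewrite !inE eqxx.
- by rewrite !inE ![w == _]eq_sym (negPf neq_uw) (negPf tw) (negPf t'w).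
move=> i j iC /notin_setD2[]->; rewrite ?inE ?eqxx ?orbT // => Giw.
by move: iC; rewrite !inE => /orP[/orP[]|] /eqP iE; move: Giw;
  rewrite iE ?(negPf nGuw) ?(negPf ntw) ?(negPf nt'w).
Qed.

Lemma link_avoid_u t t' : t \in T -> t' \in T -> ~~ G t u -> ~~ G t' u ->
  link (corank1_ideal t) (corank1_ideal t').
Proof.
move=> tT t'T ntu nt'u; apply: link_corank1 => //.
apply: (@closed_separates [set u]%SET).
- by rewrite inE.
- by rewrite inE eq_sym.
move=> i j /set1P-> /notin_setD2[]->; rewrite ?finset.set11 //.
- by rewrite (negPf nGuw).
- by rewrite adj_sym (negPf ntu).
- by rewrite adj_sym (negPf nt'u).
Qed.

Lemma link_cross t t' : t \in T -> t' \in T ->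
  ~~ G t w -> ~~ G t' u -> ~~ G t t' -> link (corank1_ideal t) (corank1_ideal t').
Proof.
move=> tT t'T ntw nt'u ntt'; apply: link_corank1 => //.
have /andP[_ tw] := in_neq_uw tT.
apply: (@closed_separates [set u; t]%SET).
- by rewrite !inE eqxx.
- by rewrite !inE ![w == _]eq_sym (negPf neq_uw) (negPf tw).
move=> i j /set2P[]-> /notin_setD2[]->; rewrite ?finset.set21 ?finset.set22 //.
- by rewrite (negPf nGuw).
- by rewrite adj_sym (negPf nt'u).
- by rewrite (negPf ntw).
- by rewrite (negPf ntt').
Qed.

Lemma link_to_corank1 z : interval z -> exists t,
  [/\ t \in T, ~~ (G t u && G t w) & link z (corank1_ideal t)].
Proof.
move=> Iz; have [zT sep] := interval_separates Iz.
have [_ [t tT tz]] := properP zT; exists t; split=> //.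
  apply: contra sep => /andP[Gtu Gtw].
  have notinz a : a \notin T -> a \notin vset z.
    by apply: contra; apply/fintype.subsetP/proper_sub.
  apply: (@connect_trans _ _ t); apply: connect1;
    by rewrite /deletion /= ?tz ?notinz ?u_notin ?w_notin //= adj_sym.
apply: (@rt_trans _ _ _ (@comp_ideal K n G (vset z) (vset z))).
  apply: linkC; apply: link_sub => //; first exact: comp_ideal_interval.
  have [zM _] := Iz; have [_ [zI _ _]] := zM.
  by apply: block_sub => // [v /vsetP//|i j _ _]; apply: MG_prime_component.
by apply: link_comp => //; [rewrite subsetD1 tz proper_sub|apply: properD1].
Qed.

(** The classes of the vertices of T not adjacent to w and of those not adjacent
to u are each linked, and are linked to one another by a common vertex or by a
pair of nonadjacent vertices; if neither exists, the two classes are the sets V1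
and V2 of the family. *)
Lemma interval_connected : ~ in_family_GT T G -> poset_connected (@prec S) interval.
Proof.
move=> nfam z z' /link_to_corank1[t [tT ht zt]] /link_to_corank1[t' [t'T ht' z't']].
apply: rt_trans zt _; apply: rt_trans (linkC z't').
pose V1 := finset (fun v => (v \in T) && ~~ G v w).
pose V2 := finset (fun v => (v \in T) && ~~ G v u).
pose V0 := finset (fun v => [&& v \in T, G v u & G v w]).
have cross a b : a \in V1 -> b \in V2 -> link (corank1_ideal a) (corank1_ideal b).
  rewrite !inE => /andP[aT naw] /andP[bT nbu].
  have [[v [vT nvw nvu]]|dis] := pselect (exists v, [/\ v \in T, ~~ G v w & ~~ G v u]).
    by apply: (@rt_trans _ _ _ (corank1_ideal v));
      [apply: link_avoid_w|apply: link_avoid_u].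
  have [[v1 [v2 [v1T nv1w v2T nv2u nv12]]]|join] := pselect (exists v1 v2,
      [/\ v1 \in T, ~~ G v1 w, v2 \in T, ~~ G v2 u & ~~ G v1 v2]).
    apply: (@rt_trans _ _ _ (corank1_ideal v1)); first exact: link_avoid_w.
    apply: (@rt_trans _ _ _ (corank1_ideal v2)); first exact: link_cross.
    exact: link_avoid_u.
  have dis' v : v \in T -> G v w || G v u.
    move=> vT; rewrite -[_ || _]negbK negb_or; apply/negP => /andP[nvw nvu].
    by apply: dis; exists v.
  case: nfam; exists u, w, V0, V1, V2; split.
  - by [].
  - split; rewrite -finset.setI_eq0; apply/eqP/setP => v; rewrite !inE;
      have := dis' v; by case: (v \in T) => //= /(_ isT); case: (G v u); case: (G v w).
  - split.
    + by apply/set0Pn; exists a; rewrite inE aT.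
    + by apply/set0Pn; exists b; rewrite inE bT.
    apply/setP => v; rewrite !inE; have := dis' v.
    by case: (v \in T) => //= /(_ isT); case: (G v u); case: (G v w).
  - have nT v : v \notin T -> (G u v = false) /\ (G w v = false).
      by case/notin_uw => ->; rewrite ?adj_irr ?[G w u]adj_sym ?(negPf nGuw).
    split; apply/setP => v; rewrite !inE; have := dis' v; have := nT v;
      rewrite ![G _ v]adj_sym;
      by case: (v \in T) => /= [_ /(_ isT)|/(_ isT)[-> ->] //];
        case: (G v u); case: (G v w).
  - move=> v1 v2; rewrite !inE => /andP[v1T nv1] /andP[v2T nv2].
    by apply: contrapT => /negP n12; apply: join; exists v1, v2.
case: (boolP (G t w)) ht => [Gtw|ntw]; case: (boolP (G t' w)) ht' => [Gt'w|nt'w].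
- rewrite !andbT => nt'u ntu; exact: link_avoid_u.
- move=> _; rewrite andbT => ntu; apply: linkC.
  by apply: cross; rewrite inE ?t'T ?tT.
- rewrite andbT => nt'u _; by apply: cross; rewrite inE ?t'T ?tT.
- move=> _ _; exact: link_avoid_w.
Qed.

End Interval.

Section Criterion.
Variables (K : fieldType) (n : nat) (G : sgraph n) (T : {set 'I_n}).
Local Notation S := {mpoly K[n + n]}.
Local Notation mT := (@block_ideal K n T eq_op).

(** A separating set that misses a in N(u) and b in N(w) leaves one of the paths
u - a - w, u - b - w or u - a - b - w. So the vertex set of each member of the
interval contains N(u) or N(w), but not both, their union being T; the inclusion
of N(u) is therefore invariant along comparabilities. *)
Lemma family_disconnected : in_family_GT T G ->
  ~ poset_connected (@prec S) (MG_interval G mT).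
Proof.
case=> u [w [V0 [V1 [V2 [[neq_uw compT nGuw] [dis01 dis02 dis12]
  [V1n V2n VT] [Nu Nw] join]]]]].
have uT := u_notin compT; have wT := w_notin compT.
have Gu v : G u v = (v \in V0 :|: V1) by rewrite -Nu inE.
have Gw v : G w v = (v \in V0 :|: V2) by rewrite -Nw inE.
have sep1 : separates G u w (V0 :|: V1).
  apply: (@closed_separates _ _ _ _ [set u]%SET); rewrite ?finset.set11 //.
    by rewrite inE eq_sym.
  by move=> i j /set1P-> jV; rewrite Gu (negPf jV).
have sep2 : separates G u w (V0 :|: V2).
  rewrite /separates deletion_connect_sym.
  apply: (@closed_separates _ _ w u [set w]%SET); rewrite ?finset.set11 //.
    by rewrite inE.
  by move=> i j /set1P-> jV; rewrite Gw (negPf jV).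
have prop1 : V0 :|: V1 \proper T.
  apply/properP; split; first by rewrite -VT finset.subsetUl.
  have [v v2] := set0Pn _ V2n; exists v; first by rewrite -VT !inE v2 orbT.
  by rewrite !inE (disjointFl dis02 v2) (disjointFl dis12 v2).
have prop2 : V0 :|: V2 \proper T.
  apply/properP; split; first by rewrite -VT finset.setUAC finset.subsetUl.
  have [v v1] := set0Pn _ V1n; exists v; first by rewrite -VT !inE v1 orbT.
  by rewrite !inE (disjointFl dis01 v1) (disjointFr dis12 v1).
have dichotomy (U : {set 'I_n}) : U \subset T -> separates G u w U ->
    (V0 :|: V1 \subset U) || (V0 :|: V2 \subset U).
  move=> /fintype.subsetP UT /negP sep; rewrite -[_ || _]negbK negb_or; apply/negP.
  case/andP=> /subsetPn[a aV aU] /subsetPn[b bV bU]; apply: sep.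
  have uU : u \notin U by apply: contra uT; apply: UT.
  have wU : w \notin U by apply: contra wT; apply: UT.
  have ua : connect (deletion G U) u a.
    by apply: connect1; rewrite /deletion /= uU aU Gu.
  have bw : connect (deletion G U) b w.
    by apply: connect1; rewrite /deletion /= bU wU adj_sym Gw.
  have [aw|naw] := boolP (G w a).
    by apply: connect_trans ua (connect1 _); rewrite /deletion /= aU wU adj_sym.
  have [ub|nub] := boolP (G u b).
    by apply: connect_trans (connect1 _) bw; rewrite /deletion /= uU bU.
  apply: connect_trans ua (connect_trans (connect1 _) bw).
  rewrite /deletion /= aU bU; apply: join.
    by move: aV naw; rewrite Gw !inE; case: (a \in V0).
  by move: bV nub; rewrite Gu !inE; case: (b \in V0).
have I1 := comp_ideal_interval K compT (fintype.subxx _) prop1 sep1.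
have I2 := comp_ideal_interval K compT (fintype.subxx _) prop2 sep2.
move=> /(_ _ _ I1 I2).
suff inv z z' :
    clos_refl_trans (set S) (skeleton_adj (@prec S) (MG_interval G mT)) z z' ->
    V0 :|: V1 \subset vset z -> V0 :|: V1 \subset vset z'.
  move/inv; rewrite !vset_comp_ideal => /(_ (fintype.subxx _)) /fintype.subsetP sub.
  have [v v1] := set0Pn _ V1n; have := sub v; rewrite !inE v1 orbT => /(_ isT).
  by rewrite (disjointFl dis01 v1) (disjointFr dis12 v1).
elim=> {z z'} [z z' [Iz Iz' zz']|//|z z' z'' _ h _ h' /h/h' //].
have [zT sepz] := interval_separates neq_uw compT Iz.
have [z'T sepz'] := interval_separates neq_uw compT Iz'.
case: zz' => [[z'z _]|[zz' _]] Vz; last first.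
  by apply: fintype.subset_trans Vz _; apply: vset_mono.
case/orP: (dichotomy _ (proper_sub z'T) sepz') => // V2z'.
have Tz : T \subset vset z.
  rewrite -VT finset.subUset Vz /=.
  apply: fintype.subset_trans (vset_mono z'z).
  by apply: fintype.subset_trans V2z'; rewrite finset.subsetUr.
by move: (proper_subn zT); rewrite Tz.
Qed.

End Criterion.

(** * Cohomology of the interval above the ideal of an edge *)

Section EdgeIdeal.
Variables (K : fieldType) (n : nat) (G : sgraph n) (T : {set 'I_n}).
Variables (u w : 'I_n).
Local Notation S := {mpoly K[n + n]}.
Local Notation x := (@xvar K n).
Local Notation f := (@fbin K n).
Local Notation mT := (@block_ideal K n T eq_op).
Local Notation qT := (@block_ideal K n T (fun _ _ => true)).
Local Notation hull := (@hull K n G).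
Local Hint Resolve block_ideal_ideal : core.
Hypotheses (neq_uw : u != w) (compT : (~: T = [set u; w])%SET).

Lemma edge_ideal_sub (z : set S) : is_prime z -> T \subset vset z -> z (f u w) ->
  (qT `<=` z)%classic.
Proof.
move=> [zI _ _] /fintype.subsetP Tz zuw; apply: block_sub => // [v /Tz/vsetP//|].
move=> i j iT jT _.
have [->|->] := notin_uw compT iT; have [->|->] := notin_uw compT jT => //;
  rewrite ?fbinxx; try exact: ideal0.
by rewrite fbin_sym; apply: idealN.
Qed.

Lemma vset_edge_ideal (z : set S) : (z `<=` qT)%classic -> vset z \subset T.
Proof.
move=> zq; apply/fintype.subsetP => v /vsetP[/zq zv _].
apply: (@block_x_toric K n T (fun=> u) (fun _ _ => true)) zv => i j _ _.
by rewrite eqxx.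
Qed.

Lemma hull_interval (U : {set 'I_n}) : U \proper T -> MG_interval G qT (hull U).
Proof.
move=> UT; split; first by apply: comp_ideal_MG; apply: finset.sub0set.
apply: comp_ideal_prec => //; apply: block_mono => //; exact: proper_sub.
Qed.

(** The part of the interval that is a cone with apex the hull of the empty
set. *)
Definition lower_part : set (set S) :=
  fun z => MG_interval G qT z /\ vset z \proper T.

Lemma lower_part_hull z : lower_part z ->
  [/\ lower_part (hull (vset z)), lower_part (hull finset.set0),
      prec (hull (vset z)) z \/ hull (vset z) = z &
      prec (hull (vset z)) (hull finset.set0) \/ hull (vset z) = hull finset.set0].
Proof.
move=> [Iz zT]; have [zM _] := Iz.
have T0 : finset.set0 \proper T.
  exact: sub_proper_trans (finset.sub0set _) zT.
split.
- by split; [apply: hull_interval|rewrite vset_comp_ideal].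
- by split; [apply: hull_interval|rewrite vset_comp_ideal].
- by apply: sub_prec; apply: MG_sub_hull.
- by apply: sub_prec; apply: comp_ideal_sub; rewrite ?finset.sub0set.
Qed.

Lemma hull_mono z z' : lower_part z -> lower_part z' -> prec z z' ->
  prec (hull (vset z)) (hull (vset z')) \/ hull (vset z) = hull (vset z').
Proof.
move=> _ _ [z'z _]; apply: sub_prec; apply: comp_ideal_sub => //.
exact: vset_mono.
Qed.

Lemma adjacent_cohomology1 : G u w ->
  reduced_cohomology_eq0 (@prec S) K (MG_interval G qT) 1.
Proof.
move=> Guw; apply: (cone_cohomology1 (@prec_trans S) (@prec_irr S) _
  lower_part_hull hull_mono); first by move=> z [].
move=> z Iz; split=> //; have [[zS zP] [zq nqz]] := Iz.
rewrite properE vset_edge_ideal //=; apply/negP => Tz; apply: nqz.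
apply: edge_ideal_sub => //; have [_ Gz _] := spanned_stage zS; exact: Gz.
Qed.

(** The ideal m of the variables of T is the only member of the interval outside
the lower part: if its vertex set is T, it is generated over m by binomials
f_ij, and f_uw is excluded. *)
Lemma nonadjacent_cohomology1 : ~~ G u w ->
  reduced_cohomology_eq0 (@prec S) K (MG_interval G qT) 1 <->
  poset_connected (@prec S) (MG_interval G mT).
Proof.
move=> nGuw; have uT := u_notin compT; have wT := w_notin compT.
have mE : mT = @comp_ideal K n G T T.
  apply: eq_block => i j iT jT; apply/eqP/idP => [->|ij]; first exact: connect0.
  apply/eqP; apply: contrapT => /negP nij.
  case/connectP: ij nij => -[|a s] /= => [_ ->|]; first by rewrite eqxx.
  case/andP => /and3P[_ aT]; have [->|->] := notin_uw compT iT;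
    have [->|->] := notin_uw compT aT; rewrite ?adj_irr ?(negPf nGuw) //.
  by rewrite adj_sym (negPf nGuw).
have mq : prec qT mT.
  apply: (@proper_witness _ _ _ (f u w)); first exact: block_mono.
    exact: block_f.
  by move/(block_eq_f uT wT)/eqP; apply/negP.
have mI : MG_interval G qT mT by split=> //; rewrite mE; apply: comp_ideal_MG.
have vm : vset mT = T by rewrite mE vset_comp_ideal.
have split_interval z : MG_interval G qT z -> z = mT \/ lower_part z.
  move=> Iz; have [[zS zP] [zq nqz]] := Iz; have zT := vset_edge_ideal zq.
  have [Tz|nTz] := boolP (T \subset vset z); last first.
    by right; split=> //; rewrite properE zT.
  left; apply/seteqP; split; last exact: eq_ideal_sub.
  have [_ _ zG] := spanned_stage zS; apply: subset_trans zG _.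
  apply: block_mono => // i j iT jT /andP[/asboolP zij _].
  have nzuw : ~ z (f u w) by move=> zuw; apply: nqz; apply: edge_ideal_sub.
  move: zij; have [->|->] := notin_uw compT iT; have [->|->] := notin_uw compT jT;
    rewrite ?eqxx // => zij.
  by case: nzuw; rewrite fbin_sym; apply: idealN => //; case: zP.
have nlow : ~ lower_part mT by move=> [_]; rewrite vm fintype.properxx.
have low_sub z : lower_part z -> MG_interval G qT z by case.
have minm z : MG_interval G qT z -> ~ prec z mT.
  move=> Iz [mz nzm]; case: (split_interval z Iz) => [zm|[_ zT]].
    by apply: nzm; rewrite zm.
  have := vset_mono mz; rewrite vm => Tz.
  by move: (proper_subn zT); rewrite Tz.
apply: (iff_trans (suspension_cohomology1 K (@prec_trans S) (@prec_irr S) low_sub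
  lower_part_hull hull_mono mI nlow split_interval minm)).
suff -> : [set z | MG_interval G qT z /\ prec mT z]%classic = MG_interval G mT by [].
apply/seteqP; split=> z [].
  by move=> [zM _] mz; split.
by move=> zM mz; split=> //; split=> //; apply: prec_trans mz.
Qed.

End EdgeIdeal.

Lemma num_components_eq1 n (H : sgraph n) (T : {set 'I_n}) (u w : 'I_n) :
    (~: T = [set u; w])%SET ->
  (num_components H T == 1)%N = connect (deletion H T) u w.
Proof.
move=> compT; have uT := u_notin compT; have wT := w_notin compT.
pose C a := [set b in ~: T | connect (deletion H T) a b]%SET.
have -> : num_components H T = (C u != C w).+1.
  rewrite /num_components /components /equivalence_partition compT.
  by rewrite imsetU1 imset_set1 cards2 -compT.
have -> : connect (deletion H T) u w = (C u == C w); last by case: (C u == C w).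
apply/idP/eqP => [uw|/setP/(_ w)]; last by rewrite !inE wT connect0.
apply/setP => b; rewrite !inE.
by rewrite (same_connect (deletion_connect_sym H T) uw).
Qed.

Theorem theorem5p8 (K : fieldType) (n : nat) (G H : sgraph n)
    (T : {set 'I_n}) (q : set {mpoly K[n + n]})
    (hq : MG_poset G q) (hqP : q = P_ideal T H) (hT : (#|T| + 2 = n)%N) :
  (num_components H T = 2%N ->
     (poset_connected (@prec {mpoly K[n + n]}) (MG_interval G q)
        <-> ~ in_family_GT T G)) /\
  (num_components H T = 1%N ->
     (reduced_cohomology_eq0 (@prec {mpoly K[n + n]}) K (MG_interval G q) 1
        <-> ~ in_family_GT T G)).
Proof.
have /cards2P[u [w [neq_uw compT]]] : #|~: T| == 2.
  by rewrite cardsCs finset.setCK card_ord -{1}hT addKn.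
have uT := u_notin compT; have wT := w_notin compT.
have comp1 := num_components_eq1 H compT.
have criterion : ~~ G u w ->
    poset_connected (@prec _) (MG_interval G (@block_ideal K n T eq_op))
      <-> ~ in_family_GT T G.
  move=> nGuw; split; last exact: (interval_connected neq_uw compT nGuw).
  by move=> conn /(family_disconnected (K := K)).
split=> cH; rewrite hqP P_idealE in hq *.
  have nuw : ~~ connect (deletion H T) u w by rewrite -comp1 cH.
  have E : @block_ideal K n T (connect (deletion H T)) = @block_ideal K n T eq_op.
    apply: eq_block => i j iT jT.
    have [->|->] := notin_uw compT iT; have [->|->] := notin_uw compT jT;
      rewrite ?connect0 ?eqxx //.
      by rewrite (negPf nuw) (negPf neq_uw).
    by rewrite deletion_connect_sym (negPf nuw) eq_sym (negPf neq_uw).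
  rewrite E in hq *; apply: criterion; apply/negP => Guw.
  have [/spanned_stage[_ Gq _] _] := hq.
  by move: (block_eq_f uT wT (Gq u w Guw)) => /eqP; apply/negP.
have uw : connect (deletion H T) u w by rewrite -comp1 cH.
have -> : @block_ideal K n T (connect (deletion H T)) =
    @block_ideal K n T (fun _ _ => true).
  apply: eq_block => i j iT jT.
  have [->|->] := notin_uw compT iT; have [->|->] := notin_uw compT jT;
    by rewrite ?connect0 // deletion_connect_sym.
have [Guw|nGuw] := boolP (G u w).
  split=> _; last exact: (adjacent_cohomology1 compT Guw).
  case=> u' [w' [V0 [V1 [V2 [[neq' compT' nG'] _ _ _ _]]]]].
  move: nG' neq'; have [->|->] := notin_uw compT (u_notin compT');
    have [->|->] := notin_uw compT (w_notin compT'); rewrite ?eqxx ?Guw //.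
  by rewrite adj_sym Guw.
exact: iff_trans (nonadjacent_cohomology1 K neq_uw compT nGuw) (criterion nGuw).
Qed.
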